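(* Let $\mathbf{h}^H=\{h^H_{t_0},\dots,h^H_{t_{N-1}}\}$ and $\mathbf{h}^L=\{h^L_{t_0},\dots,h^L_{t_{N-1}}\}$ be two holding cost sequences and let $1\le n<N-1$. If $h^L_{t_i}\le h^H_{t_i}$ for all $n\le i\le N-1$, then $$b(t_n;\mathbf{h}=\mathbf{h}^H)\le b(t_n;\mathbf{h}=\mathbf{h}^L),$$ where $b(t_n;\mathbf{h}=\mathbf{c})$ denotes the threshold at time $t_n$ in the purchasing problem described in the context when the holding cost sequence is $\mathbf{c}$, all other parameters being kept the same.
   Context: Model. A single item must be purchased within a finite horizon $[0,T]$. Decisions are made on the grid $t_n = n\cdot dt$, $0\le n\le N$, with $dt>0$ and $N=T/dt$. The item's price follows the AR(1) process $X_t = \theta K\,dt + (1-K\,dt)X_{t-dt} + \sigma\varepsilon_t$, where $\theta\in\mathbb{R}$, $\sigma>0$, $|1-K\,dt|<1$, and the $\varepsilon_{t_1},\varepsilon_{t_2},\dots$ are i.i.d. $N(0,dt)$. For $t_n<t_i$, $X_{t_n,t_i}(x)$ denotes the random price $X_{t_i}$ conditioned on $X_{t_n}=x$. Holding the item from $t_n$ to $t_N$ costs $dt\sum_{i=n}^{N-1}h_{t_i}$, where the per-unit-time holding costs $h_{t_0},\dots,h_{t_{N-1}}$ are real numbers that are weakly decreasing in time (a ''holding cost sequence''). Value function. $V(x,t_N)=x$ (the item must be bought at $t_N$ if not bought before), and for $0\le n<N$, $$V(x,t_n)=\min\Big\{V^C(x,t_n),\; x+dt\sum_{i=n}^{N-1}h_{t_i}\Big\},\qquad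 V^C(x,t_n)=E\big[V(X_{t_n,t_{n+1}}(x),t_{n+1})\big].$$ Threshold. For $0\le n\le N-1$, $b(t_n)$ is the (single) real number with $V^C(b(t_n),t_n)=b(t_n)+dt\sum_{i=n}^{N-1}h_{t_i}$; by convention $b(t_N)=\infty$. *)

(* Defs.v *)
From HB Require Import structures.
From mathcomp Require Import all_boot all_order all_algebra.
From mathcomp Require Import finmap.
From mathcomp Require Import all_classical all_reals all_analysis.

Set Implicit Arguments.
Unset Strict Implicit.
Unset Printing Implicit Defensive.

Import Order.TTheory GRing.Theory Num.Theory.
Import numFieldNormedType.Exports.

Local Open Scope classical_set_scope.
Local Open Scope ring_scope.

(* Mutual independence of the random variables X i, i \in D: the product rule
   over every finite subfamily. *)
Definition mutually_independent (R : realType) (d : measure_display)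
    (Omega : measurableType d) (P : probability Omega R) (I : choiceType)
    (D : set I) (X : I -> {RV P >-> R}) : Prop :=
  forall (J : {fset I}) (A : I -> set R),
    [set` J] `<=` D ->
    (forall i, i \in J -> measurable (A i)) ->
    P (\bigcap_(i in [set` J]) (X i @^-1` A i))
    = (\prod_(i <- J) P (X i @^-1` A i))%E.

(* The noise eps i is used at time t_i = i * dt, 1 <= i <= N.
   The second parameter of normal_prob is the standard deviation. *)
Definition iid_gaussian_noise (R : realType) (d : measure_display)
    (Omega : measurableType d) (P : probability Omega R) (dt : R) (N : nat)
    (eps : nat -> {RV P >-> R}) : Prop :=
  mutually_independent [set i | (1 <= i <= N)%N] eps /\
  forall i, (1 <= i <= N)%N -> forall A : set R, measurable A ->
    distribution P (eps i) A = normal_prob 0 (Num.sqrt dt) A.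

Definition holding_cost_sequence (R : realType) (N : nat) (h : 'I_N -> R) :
    Prop :=
  forall i j : 'I_N, (i <= j)%N -> h j <= h i.

Definition remaining_holding_cost (R : realType) (dt : R) (N : nat)
    (h : 'I_N -> R) (n : nat) : R :=
  dt * \sum_(i < N | (n <= i)%N) h i.

(* price theta K sigma dt eps n x k is X_{t_n, t_(n+k)}(x). Since X_{t_n} is
   independent of the later noise, conditioning on X_{t_n} = x amounts to
   running the AR(1) recursion from the value x at time t_n. *)
Fixpoint price (R : realType) (d : measure_display)
    (Omega : measurableType d) (P : probability Omega R)
    (theta K sigma dt : R) (eps : nat -> {RV P >-> R})
    (n : nat) (x : R) (k : nat) (w : Omega) : R :=
  match k with
  | 0%N => x
  | k'.+1 => theta * K * dt
             + (1 - K * dt) * price theta K sigma dt eps n x k' w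
             + sigma * eps (n + k)%N w
  end.

(* The value function with m = N - n periods to go. It grows at most linearly
   in x, so the expectation is that of an integrable random variable and fine
   loses no information. *)
Fixpoint value_to_go (R : realType) (d : measure_display)
    (Omega : measurableType d) (P : probability Omega R)
    (theta K sigma dt : R) (N : nat) (eps : nat -> {RV P >-> R})
    (h : 'I_N -> R) (m : nat) (x : R) : R :=
  match m with
  | 0%N => x
  | m'.+1 =>
      Num.min
        (fine 'E_P[fun w => value_to_go theta K sigma dt eps h m'
                              (price theta K sigma dt eps (N - m) x 1 w)])
        (x + remaining_holding_cost dt h (N - m))
  end.

Definition value (R : realType) (d : measure_display)
    (Omega : measurableType d) (P : probability Omega R)
    (theta K sigma dt : R) (N : nat) (eps : nat -> {RV P >-> R})
    (h : 'I_N -> R) (x : R) (n : nat) : R :=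
  value_to_go theta K sigma dt eps h (N - n) x.

Definition continuation_value (R : realType) (d : measure_display)
    (Omega : measurableType d) (P : probability Omega R)
    (theta K sigma dt : R) (N : nat) (eps : nat -> {RV P >-> R})
    (h : 'I_N -> R) (x : R) (n : nat) : R :=
  fine 'E_P[fun w => value theta K sigma dt eps h
                       (price theta K sigma dt eps n x 1 w) n.+1].

Lemma value_last (R : realType) (d : measure_display)
    (Omega : measurableType d) (P : probability Omega R)
    (theta K sigma dt : R) (N : nat) (eps : nat -> {RV P >-> R})
    (h : 'I_N -> R) (x : R) :
  value theta K sigma dt eps h x N = x.
Proof. by rewrite /value subnn. Qed.

Lemma valueE (R : realType) (d : measure_display)
    (Omega : measurableType d) (P : probability Omega R)
    (theta K sigma dt : R) (N : nat) (eps : nat -> {RV P >-> R})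
    (h : 'I_N -> R) (x : R) (n : nat) : (n < N)%N ->
  value theta K sigma dt eps h x n
  = Num.min (continuation_value theta K sigma dt eps h x n)
            (x + remaining_holding_cost dt h n).
Proof.
move=> nN; rewrite /continuation_value /value.
have -> : (N - n = (N - n.+1).+1)%N by rewrite -subSn.
by cbn [value_to_go]; rewrite -subSn// subSS subKn // ltnW.
Qed.

(* For n < N the threshold b(t_n) is the real number selected by get, i.e. the
   unique solution b of the indifference equation; uniqueness and existence
   hold because x |-> V^C(x, t_n) is Lipschitz with constant |1 - K dt| < 1. *)
Definition threshold (R : realType) (d : measure_display)
    (Omega : measurableType d) (P : probability Omega R)
    (theta K sigma dt : R) (N : nat) (eps : nat -> {RV P >-> R})
    (h : 'I_N -> R) (n : nat) : \bar R :=
  if (n < N)%N then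
    (get [set b : R | continuation_value theta K sigma dt eps h b n
                      = b + remaining_holding_cost dt h n])%:E
  else +oo%E.

(* Main.v *)
(* Let S h n be the remaining holding cost and D n = S hH n - S hL n, which is
   nonincreasing on the later times. Backward induction gives V^H - V^L <= D n,
   since the expectation passes on D n.+1 <= D n and the immediate costs differ
   by exactly D n. At b = b(t_n; hH) this reads V^C_L b >= b + S hL n. As V^C_L
   is a strict contraction, V^C_L x - x is strictly decreasing, so b lies to the
   left of the point where it equals S hL n. Integrability of the values rests
   on the values being 1-Lipschitz in x and the noise having a first moment. *)

Require Import Defs.
From HB Require Import structures.
From mathcomp Require Import all_boot all_order all_algebra.
From mathcomp Require Import finmap.
From mathcomp Require Import all_classical all_reals all_analysis.
From mathcomp Require Import measurable_realfun ring lra.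

Set Implicit Arguments.
Unset Strict Implicit.
Unset Printing Implicit Defensive.

Import Order.TTheory GRing.Theory Num.Theory.
Import numFieldNormedType.Exports.

Local Open Scope classical_set_scope.
Local Open Scope ring_scope.

(** * First absolute moment of a centred Gaussian *)

(** The Radon-Nikodym derivative of [normal_prob m s] and [normal_pdf m s] have the same integral
    over every measurable set, hence agree almost everywhere. *)
Lemma ge0_integral_normal_prob (R : realType) (m s : R) (f : R -> \bar R) :
  measurable_fun [set: R] f -> (forall x, 0 <= f x)%E ->
  (\int[normal_prob m s]_x f x
   = \int[lebesgue_measure]_x (f x * (normal_pdf m s x)%:E))%E.
Proof.
move=> mf f_ge0.
have dom := normal_prob_dominates m s.
have rn_int := Radon_Nikodym_SigmaFinite.f_integrable dom.
rewrite -(Radon_Nikodym_SigmaFinite.change_of_variables dom)//.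
have mpdf : measurable_fun setT (EFin \o normal_pdf m s).
  by apply/measurable_EFinP; exact: measurable_normal_pdf.
apply: ge0_ae_eq_integral => //.
- by apply: emeasurable_funM => //; exact: measurable_int rn_int.
- exact: emeasurable_funM.
- by move=> x _; rewrite mule_ge0// Radon_Nikodym_SigmaFinite.f_ge0.
- by move=> x _; rewrite mule_ge0// lee_fin normal_pdf_ge0.
- apply: ae_eqe_mul2l; apply: integral_ae_eq => // E _ mE.
  by rewrite -Radon_Nikodym_SigmaFinite.f_integral.
Qed.

Lemma norm_normal_pdf_le (R : realType) (s x : R) : 0 < s ->
  `|x| * normal_pdf 0 s x
  <= 2 * s * Num.sqrt 2 * normal_pdf 0 (Num.sqrt 2 * s) x.
Proof.
move=> s_gt0.
have r2_gt0 : 0 < Num.sqrt 2 :> R by rewrite sqrtr_gt0.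
have r2s_gt0 : 0 < Num.sqrt 2 * s by rewrite mulr_gt0.
rewrite !normal_pdfE ?gt_eqF//.
have -> : normal_peak (Num.sqrt 2 * s) = (Num.sqrt 2)^-1 * normal_peak s.
  rewrite /normal_peak exprMn -mulrA -mulrnAr sqrtrM ?sqr_ge0//.
  by rewrite sqrtr_sqr gtr0_norm// invfM.
have -> : normal_fun 0 s x
    = expR (- (x / (2 * s)) ^+ 2) * normal_fun 0 (Num.sqrt 2 * s) x.
  rewrite /normal_fun -expRD; congr expR.
  by rewrite !exprMn sqr_sqrtr//; field; rewrite gt_eqF.
(* y <= 1 + y^2 <= exp (y^2) at y = |x| / (2 s): half of the Gaussian exponent
   absorbs the factor |x|, leaving a density of variance 2 s^2. *)
have x_le : `|x| * expR (- (x / (2 * s)) ^+ 2) <= 2 * s.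
  rewrite expRN ler_pdivrMr ?expR_gt0//.
  have -> : `|x| = 2 * s * `|x / (2 * s)|.
    rewrite normrM normfV (gtr0_norm (mulr_gt0 _ _))// mulrCA divff ?mulr1//.
    by rewrite gt_eqF ?mulr_gt0.
  rewrite ler_pM2l ?mulr_gt0//; apply: le_trans (expR_ge1Dx _).
  rewrite -real_normK ?num_real//.
  by have := sqr_ge0 (`|x / (2 * s)| - 2^-1); lra.
have -> : 2 * s * Num.sqrt 2 * ((Num.sqrt 2)^-1 * normal_peak s
    * normal_fun 0 (Num.sqrt 2 * s) x)
    = 2 * s * (normal_peak s * normal_fun 0 (Num.sqrt 2 * s) x).
  by field; rewrite gt_eqF.
rewrite [leLHS](_ : _ = `|x| * expR (- (x / (2 * s)) ^+ 2)
    * (normal_peak s * normal_fun 0 (Num.sqrt 2 * s) x)); last by ring.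
by rewrite ler_wpM2r// mulr_ge0 ?normal_peak_ge0 ?normal_fun_ge0.
Qed.

(** The integrand is dominated by a constant times the Gaussian density of standard deviation
    [Num.sqrt 2 * s], which has total mass 1. *)
Lemma normal_prob_norm_lty (R : realType) (s : R) : 0 < s ->
  (\int[normal_prob 0 s]_x `|x|%:E < +oo)%E.
Proof.
move=> s_gt0.
rewrite ge0_integral_normal_prob//; last first.
  by apply/measurable_EFinP.
pose c := 2 * s * Num.sqrt 2.
have c_ge0 : 0 <= c by rewrite !mulr_ge0 ?sqrtr_ge0 ?ltW.
apply: (@le_lt_trans _ _
    (\int[lebesgue_measure]_x (c%:E * (normal_pdf 0 (Num.sqrt 2 * s) x)%:E))%E).
  apply: ge0_le_integral => //=.
  - by move=> x _; rewrite lee_fin mulr_ge0// normal_pdf_ge0.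
  - apply/measurable_EFinP; apply: measurable_funM.
      exact: normr_measurable.
    exact: measurable_normal_pdf.
  - apply/measurable_EFinP; apply: measurable_funM => //.
    exact: measurable_normal_pdf.
  - by move=> x _; rewrite lee_fin norm_normal_pdf_le.
rewrite ge0_integralZl//=.
- by rewrite integral_normal_pdf mule1 ltry.
- by apply/measurable_EFinP; exact: measurable_normal_pdf.
- by move=> x _; rewrite lee_fin normal_pdf_ge0.
Qed.

Lemma normal_Lfun1 (R : realType) (d : measure_display)
    (Omega : measurableType d) (P : probability Omega R) (X : {RV P >-> R})
    (s : R) : 0 < s ->
  (forall A : set R, measurable A ->
    distribution P X A = normal_prob 0 s A) ->
  (X : Omega -> R) \in Lfun P 1.
Proof.
move=> s_gt0 XE; apply/Lfun1_integrable/integrableP; split.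
  exact/measurable_EFinP.
under eq_integral do rewrite /= -abse_EFin.
(* [normal_prob] is a measure on [measurableTypeR R], whose display differs from
   the default one of [R]: [X] is repackaged to share that codomain. *)
have mX : @measurable_fun _ _ Omega (measurableTypeR R) setT X.
  exact: (measurable_funPT X).
pose X' : {RV P >-> measurableTypeR R} :=
  @mfun_Sub _ _ Omega (measurableTypeR R) X (mem_set mX).
have -> : (\int[P]_w `|(X w)%:E| = \int[distribution P X']_y `|y|%:E)%E.
  rewrite ge0_integral_distribution//.
  by apply/measurable_EFinP.
have -> : (\int[distribution P X']_y `|y|%:E
    = \int[normal_prob 0 s]_y `|y|%:E)%E.
  by apply: eq_measure_integral => A mA _; exact: XE.
exact: normal_prob_norm_lty.
Qed.

(** * Lipschitz maps, expectations and strict contractions *)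

Lemma lipschitz1_continuous (R : realType) (f : R -> R) :
  (forall x y, `|f x - f y| <= `|x - y|) -> continuous f.
Proof.
move=> f_lip x; apply/cvgrPdist_lt => e e_gt0; near=> y.
apply: le_lt_trans (f_lip x y) _; near: y.
by apply: (@cvgr_dist_lt _ _ _ (nbhs x) _ id x).
Unshelve. all: by end_near. Qed.

(** The integrable bound is [|f 0| + |X|]; measurability comes from continuity. *)
Lemma lipschitz1_comp_Lfun1 (R : realType) (d : measure_display)
    (Omega : measurableType d) (P : probability Omega R) (f : R -> R)
    (X : Omega -> R) :
  (forall x y, `|f x - f y| <= `|x - y|) -> X \in Lfun P 1 ->
  f \o X \in Lfun P 1.
Proof.
move=> f_lip LX; apply/Lfun1_integrable.
have Labs : (cst `|f 0| \+ (Num.norm \o X)) \in Lfun P 1.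
  by apply: rpredD => //; [exact: Lfun_cst | exact: Lfun_norm].
move/Lfun1_integrable: Labs; apply: le_integrable => //.
  apply/measurable_EFinP; apply: measurableT_comp.
    by apply: continuous_measurable_fun; exact: lipschitz1_continuous.
  by have := sub_Lfun_mfun LX; rewrite inE.
move=> w _ /=; rewrite lee_fin [leRHS]ger0_norm ?addr_ge0//.
rewrite -[f (X w)](subrK (f 0)) addrC (le_trans (ler_normD _ _))// lerD2l.
by rewrite (le_trans (f_lip _ _))// subr0.
Qed.

(** Integrability makes both expectations finite, so that [fine], which sends infinities to 0,
    preserves their order. *)
Lemma fine_expectation_leD (R : realType) (d : measure_display)
    (Omega : measurableType d) (P : probability Omega R) (X Y : Omega -> R)
    (c : R) :
  X \in Lfun P 1 -> Y \in Lfun P 1 -> (forall w, X w <= Y w + c) ->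
  fine 'E_P[X] <= fine 'E_P[Y] + c.
Proof.
move=> LX LY XY.
have LYc : Y \+ cst c \in Lfun P 1 by rewrite rpredD// Lfun_cst.
have : (0 <= 'E_P[((Y \+ cst c) \- X)%R])%E.
  by apply: expectation_ge0 => w /=; rewrite subr_ge0.
rewrite expectationB// expectationD ?Lfun_cst// expectation_cst.
rewrite -(fineK (expectation_fin_num LX)) -(fineK (expectation_fin_num LY)).
by rewrite -!EFinD lee_fin subr_ge0.
Qed.

(** The function [f x - x] takes values on both sides of [s] at the ends of a large interval, and
    the intermediate value theorem applies. *)
Lemma contraction_shift_fixpoint (R : realType) (f : R -> R) (k s : R) :
  k < 1 -> (forall x y, `|f x - f y| <= k * `|x - y|) ->
  exists b, f b = b + s.
Proof.
move=> k_lt1 f_lip.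
have f_cont : continuous f.
  apply: lipschitz1_continuous => x y; apply: le_trans (f_lip x y) _.
  by rewrite ler_piMl// ltW.
(* From 0 to [M], [f x - x] falls by at least [(1 - k) * M]; this [M] makes that amount equal to the
   gap [|f 0 - s|] to be closed, and symmetrically towards [- M]. *)
pose M := `|f 0 - s| / (1 - k).
have k1_gt0 : 0 < 1 - k by rewrite subr_gt0.
have M_ge0 : 0 <= M by rewrite divr_ge0// ltW.
have ME : M = k * M + `|f 0 - s|.
  by rewrite /M; field; rewrite gt_eqF.
have g_cont : continuous (fun x => f x - x).
  by move=> x; apply: cvgB; [exact: f_cont | exact: cvg_id].
have gM : f M - M <= s.
  have := le_trans (ler_norm _) (f_lip M 0).
  have := ler_norm (f 0 - s); rewrite subr0 (ger0_norm M_ge0); lra.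
have gNM : s <= f (- M) - - M.
  have := le_trans (ler_norm _) (f_lip 0 (- M)).
  have := ler_norm (- (f 0 - s)); rewrite normrN sub0r opprK (ger0_norm M_ge0).
  lra.
have [|||b _ fb] := @IVT R (fun x => f x - x) (- M) M s.
- by rewrite ge0_cp.
- exact: continuous_subspaceT.
- by rewrite ge_min le_max gM gNM orbT.
- by exists b; rewrite -fb addrC subrK.
Qed.

(** * Regularity and comparison of the value functions *)

Section purchasing.
Variables (R : realType) (d : measure_display) (Omega : measurableType d)
  (P : probability Omega R) (theta K sigma dt : R) (N : nat)
  (eps : nat -> {RV P >-> R}).
Hypotheses (dt_gt0 : 0 < dt) (Kdt : `|1 - K * dt| < 1)
  (noise : iid_gaussian_noise dt N eps).

Local Notation price1 n x := (price theta K sigma dt eps n x 1).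
Local Notation V h := (value theta K sigma dt eps h).
Local Notation VC h := (continuation_value theta K sigma dt eps h).
Local Notation S h := (remaining_holding_cost dt h).

Lemma price1_Lfun1 n x : (n < N)%N -> price1 n x \in Lfun P 1.
Proof.
move=> nN.
have Leps : (eps (n + 1)%N : Omega -> R) \in Lfun P 1.
  have sqrt_gt0 : 0 < Num.sqrt dt by rewrite sqrtr_gt0.
  apply: (normal_Lfun1 sqrt_gt0); apply: noise.2.
  by rewrite addn1.
have -> : price1 n x
    = cst (theta * K * dt + (1 - K * dt) * x) \+ (sigma \o* eps (n + 1)%N).
  by apply/funext => w /=; rewrite (mulrC sigma).
by rewrite rpredD// ?Lfun_cst// Lfun_scale.
Qed.

(** Two prices started from [x] and [y] share the same noise, so one step later they differ by
    exactly [(1 - K * dt) * (x - y)]. *)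
Lemma continuation_value_lipschitz (h : 'I_N -> R) n : (n < N)%N ->
  (forall x y, `|V h x n.+1 - V h y n.+1| <= `|x - y|) ->
  forall x y, `|VC h x n - VC h y n| <= `|1 - K * dt| * `|x - y|.
Proof.
move=> nN V_lip.
have le x y : VC h x n <= VC h y n + `|1 - K * dt| * `|x - y|.
  apply: fine_expectation_leD => [||w].
  - exact: (@lipschitz1_comp_Lfun1 _ _ _ _ (V h ^~ n.+1) _ V_lip
      (price1_Lfun1 x nN)).
  - exact: (@lipschitz1_comp_Lfun1 _ _ _ _ (V h ^~ n.+1) _ V_lip
      (price1_Lfun1 y nN)).
  - rewrite -lerBlDl (le_trans (ler_norm _))// (le_trans (V_lip _ _))//=.
    rewrite -normrM le_eqVlt; apply/orP; left; apply/eqP; congr Num.norm; ring.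
move=> x y; have := le x y; have := le y x; rewrite (distrC y x) => yx xy.
by rewrite ler_norml; apply/andP; split; lra.
Qed.

(** Both arguments of the minimum are 1-Lipschitz: the continuation value contracts, and the
    immediate cost is a translation of [x]. *)
Lemma value_lipschitz (h : 'I_N -> R) n : (n <= N)%N ->
  forall x y, `|V h x n - V h y n| <= `|x - y|.
Proof.
(* Writing [n] as [N - m] turns backward induction in time into induction on the number [m] of
   periods to go. *)
move=> nN; rewrite -(subKn nN); elim: (N - n)%N (leq_subr n N) => [|m IHm] mN.
  by move=> x y; rewrite subn0 !value_last.
have mN' : (N - m.+1 < N)%N by rewrite ltn_subrL (leq_trans _ mN).
have VC_lip := @continuation_value_lipschitz h _ mN'.
rewrite -subSn// subSS in VC_lip; have {}VC_lip := VC_lip (IHm (ltnW mN)).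
have le x y : V h x (N - m.+1) <= V h y (N - m.+1) + `|x - y|.
  rewrite !valueE// -lerBlDr le_min !lerBlDr !ge_min.
  have VC_le : VC h x (N - m.+1) <= VC h y (N - m.+1) + `|x - y|.
    rewrite -lerBlDl (le_trans (ler_norm _))// (le_trans (VC_lip _ _))//.
    by rewrite ler_piMl// ltW.
  rewrite VC_le/=; apply/orP; right.
  by have := ler_norm (x - y); lra.
move=> x y; have := le x y; have := le y x; rewrite (distrC y x) => yx xy.
by rewrite ler_norml; apply/andP; split; lra.
Qed.

(** The difference of the costs is [dt] times a sum of gaps [hH i - hL i]; starting later only drops
    nonnegative ones. *)
Lemma remaining_holding_costB_le (hH hL : 'I_N -> R) m n : (m <= n)%N ->
  (forall i : 'I_N, (m <= i)%N -> hL i <= hH i) ->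
  S hH n - S hL n <= S hH m - S hL m.
Proof.
move=> mn hLH.
rewrite -!mulrBr ler_pM2l// -!sumrB big_mkcond [leRHS]big_mkcond/=.
apply: ler_sum => i _; case: ifPn => [ni|_].
  by rewrite (leq_trans mn ni).
by case: ifPn => // mi; rewrite subr_ge0 hLH.
Qed.

Lemma continuation_value_leD (hH hL : 'I_N -> R) c x n : (n < N)%N ->
  (forall y, V hH y n.+1 <= V hL y n.+1 + c) -> VC hH x n <= VC hL x n + c.
Proof.
move=> nN V_le; apply: fine_expectation_leD => [||w]; last exact: V_le.
- exact: (@lipschitz1_comp_Lfun1 _ _ _ _ (V hH ^~ n.+1) _
    (@value_lipschitz hH n.+1 nN) (price1_Lfun1 x nN)).
- exact: (@lipschitz1_comp_Lfun1 _ _ _ _ (V hL ^~ n.+1) _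
    (@value_lipschitz hL n.+1 nN) (price1_Lfun1 x nN)).
Qed.

Lemma value_leD (hH hL : 'I_N -> R) n x : (n <= N)%N ->
  (forall i : 'I_N, (n <= i)%N -> hL i <= hH i) ->
  V hH x n <= V hL x n + (S hH n - S hL n).
Proof.
move=> nN; rewrite -(subKn nN).
elim: (N - n)%N (leq_subr n N) x => [|m IHm] mN x hLH.
  (* At the horizon both values are [x] and both cost sums are empty. *)
  rewrite subn0 !value_last /remaining_holding_cost !big1 ?subrr ?addr0//.
    by move=> i; rewrite leqNgt ltn_ord.
  by move=> i; rewrite leqNgt ltn_ord.
have mN' : (N - m.+1 < N)%N by rewrite ltn_subrL (leq_trans _ mN).
have mE : (N - m.+1).+1 = (N - m)%N by rewrite -subSn.
have S_le := remaining_holding_costB_le (leqnSn (N - m.+1)) hLH.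
have VC_le : VC hH x (N - m.+1) <= VC hL x (N - m.+1)
    + (S hH (N - m.+1) - S hL (N - m.+1)).
  (* The induction hypothesis gives the cost gap [c] of the next time, at most the current gap by
     [S_le]. *)
  pose c := S hH (N - m.+1).+1 - S hL (N - m.+1).+1.
  apply: le_trans (continuation_value_leD (c := c) x mN' _) _.
    move=> y; rewrite /c mE; apply: IHm; first exact: ltnW.
    by move=> i mi; apply: hLH; rewrite (leq_trans _ mi)// leq_sub2l.
  by rewrite lerD2l.
rewrite !valueE// -lerBlDr le_min !lerBlDr !ge_min VC_le/=.
by apply/orP; right; lra.
Qed.

(** Existence of a solution guarantees that [get] returns one rather than a default point. *)
Lemma thresholdP (h : 'I_N -> R) n : (n < N)%N ->
  exists2 b, threshold theta K sigma dt eps h n = b%:E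
           & VC h b n = b + S h n.
Proof.
move=> nN; rewrite /threshold nN.
have [b bE] := contraction_shift_fixpoint (S h n) Kdt
  (continuation_value_lipschitz nN (@value_lipschitz h _ nN)).
by eexists; [reflexivity | exact: (@getI _ [set b | VC h b n = b + S h n] b)].
Qed.

End purchasing.

(** * Comparison of the thresholds *)

Theorem lemma5 (R : realType) (d : measure_display)
    (Omega : measurableType d) (P : probability Omega R)
    (theta K sigma dt T : R) (N : nat) (eps : nat -> {RV P >-> R})
    (hH hL : 'I_N -> R) (n : nat)
    (sigma_gt0 : 0 < sigma) (dt_gt0 : 0 < dt) (NE : N%:R = T / dt)
    (Kdt : `|1 - K * dt| < 1)
    (noise : iid_gaussian_noise dt N eps)
    (hH_cost : holding_cost_sequence hH) (hL_cost : holding_cost_sequence hL)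
    (n_range : (1 <= n < N - 1)%N)
    (hLH : forall i : 'I_N, (n <= i)%N -> hL i <= hH i) :
  (threshold theta K sigma dt eps hH n
    <= threshold theta K sigma dt eps hL n)%E.
Proof.
have nN : (n < N)%N.
  by case/andP: n_range => _ /leq_trans; apply; exact: leq_subr.
have [bH -> bHE] := thresholdP theta sigma dt_gt0 Kdt noise hH nN.
have [bL -> bLE] := thresholdP theta sigma dt_gt0 Kdt noise hL nN.
rewrite lee_fin leNgt; apply/negP => bLH.
have V_le y := value_leD theta sigma dt_gt0 Kdt noise y nN
  (fun i ni => hLH i (ltnW ni)).
have VC_le := continuation_value_leD dt_gt0 Kdt noise bH nN V_le.
have S_le := remaining_holding_costB_le dt_gt0 (leqnSn n) hLH.
have VC_lip := le_trans (ler_norm _) (continuation_value_lipschitz dt_gt0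
  noise nN (value_lipschitz theta sigma dt_gt0 Kdt noise hL nN) bH bL).
rewrite (gtr0_norm (x := bH - bL)) ?subr_gt0// in VC_lip.
(* The indifference equations with [VC_le] and [S_le] force the continuation value for [hL] to rise
   by at least [bH - bL] between [bL] and [bH], while [VC_lip] allows strictly less. *)
have : `|1 - K * dt| * (bH - bL) < bH - bL by rewrite gtr_pMl ?subr_gt0.
lra.
Qed.
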